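(* Let $p$ and $q$ be two primes such that $p\equiv 1 \pmod q$, and, for each integer $n\geq 1$, let $G_n$ be a group of order $pq^n$ contained in $\mathcal{C}$, where $\mathcal{C}$ is the class of all finite groups that are both minimal non-Iwasawa groups and modular groups. Then $$\lim_{n\to\infty} sd(G_n)=1.$$
   Context: All groups are finite. $L(G)$ denotes the lattice of all subgroups of a group $G$. A subgroup $H$ of $G$ is permutable if $HK=KH$ for all $K\in L(G)$. $G$ is an Iwasawa group if all its subgroups are permutable. $G$ is a modular group if the lattice $L(G)$ is modular. A minimal non-Iwasawa group is a group that is not an Iwasawa group but all of whose proper subgroups are Iwasawa groups. The subgroup commutativity degree of a finite group $G$ is $$sd(G)=\frac{1}{|L(G)|^2}\,\bigl|\{(H,K)\in L(G)^2 \mid HK=KH\}\bigr|.$$ *)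

(* Defs.v *)
From HB Require Import structures.
From mathcomp Require Import all_boot all_order all_algebra all_fingroup.

Set Implicit Arguments.
Unset Strict Implicit.
Unset Printing Implicit Defensive.

Import GroupScope.

Section SubgroupLattice.

Variable gT : finGroupType.
Implicit Types G H K : {group gT}.

(* [H * K] is the elementwise product of subsets of [gT]. *)
Definition permutable H G : bool :=
  (H \subset G) && [forall K in subgroups G, H * K == K * H].

Definition iwasawa G : bool := [forall H in subgroups G, permutable H G].

Definition minimal_non_iwasawa G : bool :=
  ~~ iwasawa G && [forall H in subgroups G, (H \proper G) ==> iwasawa H].

(* The modular law in the lattice of subgroups of [G], whose order is         *)
(* inclusion, whose meet is [:&:] and whose join is [<*>].                    *)
Definition modular_group G : bool :=
  [forall X in subgroups G, forall Y in subgroups G, forall Z in subgroups G,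
     (X \subset Z) ==> (X <*> (Y :&: Z) == (X <*> Y) :&: Z)].

Definition classC G : bool := minimal_non_iwasawa G && modular_group G.

Definition commuting_pairs G : {set {group gT} * {group gT}} :=
  [set HK in setX (subgroups G) (subgroups G) | HK.1 * HK.2 == HK.2 * HK.1].

Definition sd G : rat :=
  (#|commuting_pairs G|%:R / #|subgroups G|%:R ^+ 2)%R.

End SubgroupLattice.

(* Main.v *)
(* In an Iwasawa group every Sylow subgroup is normal, because it permutes    *)
(* with its conjugates. Let [#|G| = p * q ^ n] with [n > 1]. If a Sylow        *)
(* p-subgroup [P] had a conjugate [P'] distinct from it, the two would         *)
(* generate [G], and the modular law would make the atom [P] maximal and then  *)
(* forbid a subgroup strictly between 1 and a Sylow q-subgroup; so [P] is      *)
(* normal. A q-subgroup [H] that is not Sylow generates with [P] a proper      *)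
(* subgroup, hence is normalised by [P] and lies in every Sylow q-subgroup.    *)
(* Thus only pairs of Sylow q-subgroups may fail to commute, at most [p ^ 2]   *)
(* pairs, whereas [G] has more than [n] subgroups.                             *)
Require Import Defs.
From HB Require Import structures.
From mathcomp Require Import all_boot all_order all_algebra all_fingroup.
From mathcomp Require Import all_solvable.

Set Implicit Arguments.
Unset Strict Implicit.
Unset Printing Implicit Defensive.

Import Order.TTheory GRing.Theory Num.Theory.

Section GroupTheory.

Local Open Scope group_scope.

Variable gT : finGroupType.
Implicit Types G H K P Q R S X Y Z : {group gT}.

(** Non-commuting pairs stay bounded while the lattice grows. Once the Sylow [p]-subgroup [P] is
    normal ([Sylow_p_normal]), a subgroup that is not a Sylow [q]-subgroup permutes with every
    subgroup ([mulgC_not_Sylow]). There are at most [p] Sylow [q]-subgroups, and subgroups of order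
    [q ^ i] for each [i <= n], so [sd G >= 1 - p ^ 2 / (n + 1)] ([sd_classC_ge]), and squeezing
    gives the limit. *)

Lemma iwasawa_mulgC G H K :
  iwasawa G -> H \subset G -> K \subset G -> H * K = K * H.
Proof.
move=> /forall_inP iG HG KG.
have /andP[_ /forall_inP pH] : permutable H G by apply: iG; rewrite inE.
by apply/eqP/pH; rewrite inE.
Qed.

Lemma proper_iwasawa G H : minimal_non_iwasawa G -> H \proper G -> iwasawa H.
Proof.
case/andP=> _ /forall_inP iG ltHG.
by apply: (implyP (iG H _)) => //; rewrite inE proper_sub.
Qed.

Lemma modular_law G X Y Z :
    modular_group G -> X \subset Z -> Z \subset G -> Y \subset G ->
  X <*> (Y :&: Z) = (X <*> Y) :&: Z.
Proof.
move=> mG XZ ZG YG; have XG := subset_trans XZ ZG.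
move: mG => /forall_inP/(_ X); rewrite inE => /(_ XG).
move=> /forall_inP/(_ Y); rewrite inE => /(_ YG).
by move=> /forall_inP/(_ Z); rewrite inE => /(_ ZG)/implyP/(_ XZ)/eqP.
Qed.

(** The product of [S] with a conjugate is a subgroup, hence an [r]-group containing [S], and [S] is
    a maximal [r]-subgroup. *)
Lemma iwasawa_Sylow_normal r G S : iwasawa G -> r.-Sylow(G) S -> S <| G.
Proof.
move=> iG sylS; have SG := pHall_sub sylS.
rewrite /normal SG; apply/subsetP=> x Gx; rewrite inE.
have SxG : S :^ x \subset G by rewrite conj_subG.
have /comm_joingE joinE := iwasawa_mulgC iG SG SxG.
have rSx : r.-group (S :^ x) by rewrite pgroupJ (pHall_pgroup sylS).
have rJ : r.-group (S <*> (S :^ x)).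
  by rewrite joinE pgroupM (pHall_pgroup sylS).
have eqJS : S <*> (S :^ x) = S.
  by apply: (sub_pHall sylS rJ); rewrite ?joing_subl // join_subG SG SxG.
by rewrite (subset_trans (joing_subr S (S :^ x))) ?eqJS.
Qed.

Lemma Sylow_complement_mul G P Q p q n :
    prime p -> prime q -> p != q -> #|G| = (p * q ^ n)%N ->
    p.-Sylow(G) P -> q.-Sylow(G) Q ->
  [/\ #|P| = p, #|Q| = (q ^ n)%N & P * Q = G].
Proof.
move=> p_pr q_pr neq_pq oG sylP sylQ.
have [p_gt0 q_gt0] := (prime_gt0 p_pr, prime_gt0 q_pr).
have oP : #|P| = p.
  rewrite (card_Hall sylP) oG p_part lognM ?expn_gt0 ?p_gt0 ?q_gt0 //.
  by rewrite lognX !logn_prime // eqxx (negPf neq_pq) muln0 addn0.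
have oQ : #|Q| = (q ^ n)%N.
  rewrite (card_Hall sylQ) oG p_part lognM ?expn_gt0 ?p_gt0 ?q_gt0 //.
  by rewrite lognX !logn_prime // eqxx eq_sym (negPf neq_pq) muln1 add0n.
split=> //; apply/eqP.
rewrite eqEcard mul_subG ?(pHall_sub sylP) ?(pHall_sub sylQ) //=.
rewrite coprime_cardMg oP oQ ?oG //.
by rewrite coprimeXr // prime_coprime // dvdn_prime2.
Qed.

(** * Normality of the Sylow [p]-subgroup *)

Lemma Sylow_p_normal G p q n :
    prime p -> prime q -> p != q -> (1 < n)%N -> #|G| = (p * q ^ n)%N ->
    minimal_non_iwasawa G -> modular_group G ->
  forall P, p.-Sylow(G) P -> P <| G.
Proof.
move=> p_pr q_pr neq_pq n_gt1 oG minG modG P sylP.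
have [Q sylQ] := Sylow_exists q G; have QG := pHall_sub sylQ.
have [oP oQ _] := Sylow_complement_mul p_pr q_pr neq_pq oG sylP sylQ.
have PG := pHall_sub sylP; rewrite /normal PG.
have P_pr : prime #|P| by rewrite oP.
apply: contraT => /subsetPn[x Gx]; rewrite inE => nPx.
have PxG : P :^ x \subset G by rewrite conj_subG.
have sylPx : p.-Sylow(G) (P :^ x) by rewrite pHallJ.
(* A proper [X] is Iwasawa, so its Sylow [p]-subgroup is unique and [X] cannot contain both
   conjugates. *)
have joinG X : P \subset X -> P :^ x \subset X -> X \subset G -> X :=: G.
  move=> PX PxX XG; apply/eqP; rewrite eqEproper XG.
  apply: contra nPx => ltXG; have iX := proper_iwasawa minG ltXG.
  have sPX := pHall_subl PX XG sylP.
  by rewrite (sub_normal_Hall sPX (iwasawa_Sylow_normal iX sPX)) ?pgroupJ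
             ?(pHall_pgroup sylP).
have joinPG : P <*> (P :^ x) = G.
  by apply: joinG; rewrite ?joing_subl ?joing_subr // join_subG PG.
(* [X] is the join of [P] with [P :^ x :&: X], which is trivial or [P :^ x]. *)
have maxP X : P \subset X -> X \subset G -> X :=: P \/ X :=: G.
  move=> PX XG; have [PxX | nPxX] := boolP (P :^ x \subset X).
    by right; apply: joinG.
  left; have := modular_law modG PX XG PxG.
  rewrite joinPG (setIidPr XG) prime_TIg ?cardJg //.
  by rewrite joingG1.
have tiPQ : P :&: Q = 1.
  apply: coprime_TIg.
  by rewrite oP oQ coprimeXr // prime_coprime // dvdn_prime2.
(* As [1 < n], [R] lies strictly between 1 and [Q]; both outcomes of [maxP] for [P <*> R] contradict
   this. *)
have [R [RQ _ oR]] :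
    exists R : {group gT}, [/\ R \subset Q, R <| Q & #|R| = (q ^ 1)%N].
  apply: normal_pgroup; rewrite ?(pHall_pgroup sylQ) //.
  by rewrite oQ pfactorK // ltnW.
have RG := subset_trans RQ QG.
have PRG : P <*> R \subset G by rewrite join_subG PG.
have [joinRP | joinRP] := maxP (P <*> R)%G (joing_subl _ _) PRG.
- have /(congr1 (fun A : {set gT} => #|A|)) : R :&: P = R.
    by apply/setIidPl; rewrite -joinRP joing_subr.
  have -> : R :&: P = 1 by apply/trivgP; rewrite -tiPQ [P :&: Q]setIC setSI.
  by rewrite cards1 oR => q1; move: q_pr; rewrite -[q]expn1 -q1.
(* The join of [R] and [P] is [G], so the modular law gives [R = Q]. *)
have := modular_law modG RQ QG PG.
rewrite tiPQ joingG1 joingC joinRP (setIidPr QG).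
move/(congr1 (fun A : {set gT} => #|A|))/eqP.
by rewrite oR oQ eqn_exp2l ?prime_gt1 // => /eqP n1; rewrite -n1 in n_gt1.
Qed.

(** * Subgroups that permute *)

Lemma pgroup_not_above_normal G P p q n H :
    prime p -> prime q -> #|G| = (p * q ^ n)%N -> P <| G -> #|P| = p ->
    H \subset G -> ~~ (P \subset H) ->
  q.-group H.
Proof.
move=> p_pr q_pr oG nPG oP HG nPH.
(* Hence [P <*> H] has order [p * #|H|], which divides [p * q ^ n]. *)
have tiPH : P :&: H = 1 by rewrite prime_TIg ?oP.
have PHG : P <*> H \subset G by rewrite join_subG normal_sub.
have := cardSg PHG.
rewrite /= norm_joinEr ?(subset_trans HG) ?normal_norm // TI_cardMg // oP oG.
by rewrite dvdn_pmul2l ?prime_gt0 // => /pnat_dvd; apply; rewrite pnatX pnat_id.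
Qed.

(** Since [H] is smaller than a Sylow [q]-subgroup, [P <*> H] is proper, hence Iwasawa, and [H] is
    Sylow in it. *)
Lemma normalised_by_normal_Sylow G P p q n H :
    prime p -> prime q -> p != q -> #|G| = (p * q ^ n)%N ->
    minimal_non_iwasawa G -> P <| G -> p.-Sylow(G) P ->
    H \subset G -> q.-group H -> ~~ q.-Sylow(G) H ->
  P \subset 'N(H).
Proof.
move=> p_pr q_pr neq_pq oG minG nPG sylP HG qH nsylH.
have [Q sylQ HQ] := Sylow_superset HG qH.
have [oP oQ _] := Sylow_complement_mul p_pr q_pr neq_pq oG sylP sylQ.
have ltHQ : H \proper Q.
  rewrite properEneq HQ andbT; apply: contraNneq nsylH => eqHQ.
  by rewrite (val_inj eqHQ : H = Q).
have copPH : coprime #|P| #|H|.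
  rewrite oP prime_coprime //; have [k ->] := p_natP qH.
  by rewrite Euclid_dvdX // dvdn_prime2 // (negPf neq_pq).
have PHG : P <*> H \subset G by rewrite join_subG normal_sub.
have oPH : #|P <*> H| = (p * #|H|)%N.
  rewrite norm_joinEr ?(subset_trans HG) ?normal_norm //.
  by rewrite coprime_cardMg // oP.
have ltPHG : (P <*> H)%G \proper G.
  rewrite properEcard PHG oPH oG -oQ ltn_pmul2l ?prime_gt0 //.
  exact: proper_card.
have sylH : q.-Sylow(P <*> H) H.
  rewrite pHallE joing_subr oPH partnM ?cardG_gt0 ?(prime_gt0 p_pr) //=.
  rewrite (part_pnat_id qH) part_p'nat ?mul1n //.
  by rewrite p'natE // dvdn_prime2 // eq_sym.
have := normal_norm (iwasawa_Sylow_normal (proper_iwasawa minG ltPHG) sylH).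
exact: subset_trans (joing_subl P H).
Qed.

(* Modulo [P] both subgroups come from the Iwasawa group [Q]. *)
Lemma mulgC_above_normal G P Q H K :
    P <| G -> P * Q = G -> iwasawa Q ->
    P \subset H -> H \subset G -> K \subset G ->
  H * K = K * H.
Proof.
move=> nPG defG iQ PH HG KG.
have above X : P \subset X -> X \subset G -> P * (Q :&: X) = X.
  by move=> PX XG; rewrite group_modl // defG (setIidPr XG).
have commP (A : {set gT}) : A \subset G -> P * A = A * P.
  by move=> AG; rewrite (normC (subset_trans AG (normal_norm nPG))).
have nPK : K \subset 'N(P) by rewrite (subset_trans KG) ?normal_norm.
pose L := (P <*> K)%G.
have defL : L = P * K :> {set gT} by rewrite /= norm_joinEr.
have LG : L \subset G by rewrite join_subG normal_sub.
have PL : P \subset L by rewrite joing_subl.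
(* Replacing [K] by [P * K] changes neither product, because [H] absorbs [P]. *)
have -> : H * K = H * L by rewrite defL mulgA (mulGSid PH).
have -> : K * H = L * H by rewrite defL (commP _ KG) -mulgA (mulSGid PH).
have HQG : Q :&: H \subset G by rewrite (subset_trans (subsetIr Q H)).
have LQG : Q :&: L \subset G by rewrite (subset_trans (subsetIr Q L)).
have mulPA (A B : {set gT}) : P * A = A * P -> P * A * (P * B) = P * (A * B).
  by move=> PA; rewrite {1}PA -mulgA (mulgA P) mulGid (mulgA A) -PA mulgA.
rewrite -(above H PH HG) -(above L PL LG) !mulPA ?(commP (Q :&: H)%G) //;
  try exact: commP.
by rewrite (iwasawa_mulgC (H := Q :&: H) (K := Q :&: L) iQ) ?subsetIl.
Qed.

(** When neither subgroup contains [P], both are [q]-groups, and the aim is one Sylow [q]-subgroup,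
    itself Iwasawa, that contains both. *)
Lemma mulgC_not_Sylow G P p q n H K :
    prime p -> prime q -> p != q -> #|G| = (p * q ^ n)%N ->
    minimal_non_iwasawa G -> P <| G -> p.-Sylow(G) P ->
    H \subset G -> K \subset G -> ~~ q.-Sylow(G) H ->
  H * K = K * H.
Proof.
move=> p_pr q_pr neq_pq oG minG nPG sylP HG KG nsylH.
have [Q sylQ] := Sylow_exists q G.
have [oP oQ defG] := Sylow_complement_mul p_pr q_pr neq_pq oG sylP sylQ.
have iSyl R : q.-Sylow(G) R -> iwasawa R.
  move=> sylR; apply: (proper_iwasawa minG).
  have [_ oR _] := Sylow_complement_mul p_pr q_pr neq_pq oG sylP sylR.
  rewrite properEcard (pHall_sub sylR) oR oG ltn_Pmull ?prime_gt1 //.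
  by rewrite expn_gt0 prime_gt0.
have [PH | nPH] := boolP (P \subset H).
  exact: mulgC_above_normal nPG defG (iSyl Q sylQ) PH HG KG.
have [PK | nPK] := boolP (P \subset K).
  exact/esym/(mulgC_above_normal nPG defG (iSyl Q sylQ) PK KG HG).
have qgroup := pgroup_not_above_normal p_pr q_pr oG nPG oP.
have nHP := normalised_by_normal_Sylow p_pr q_pr neq_pq oG minG nPG sylP HG
              (qgroup H HG nPH) nsylH.
have [R sylR HR] := Sylow_superset HG (qgroup H HG nPH).
have [_ _ defG'] := Sylow_complement_mul p_pr q_pr neq_pq oG sylP sylR.
have [x Gx KRx] := Sylow_subJ sylR KG (qgroup K KG nPK).
(* In [x = y * z], the factor [y] fixes [R] and [z] normalises [H], so [R :^ x] still contains
   [H]. *)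
have : x \in R * P.
  by rewrite (normC (subset_trans (pHall_sub sylR) (normal_norm nPG))) defG'.
case/mulsgP=> y z Ry Pz def_x.
have HRx : H \subset R :^ x.
  rewrite def_x conjsgM (conjGid Ry).
  by rewrite -(normP (subsetP nHP z Pz)) conjSg.
by apply: (iwasawa_mulgC (iSyl (R :^ x)%G _)) => //; rewrite pHallJ.
Qed.

(** * Counting Sylow subgroups, pairs and subgroups *)

Lemma card_Syl_leq G p q n :
    prime p -> prime q -> p != q -> #|G| = (p * q ^ n)%N ->
  #|'Syl_q(G)| <= p.
Proof.
move=> p_pr q_pr neq_pq oG.
have [[Q sylQ] [R sylR]] := (Sylow_exists q G, Sylow_exists p G).
have [_ oQ _] := Sylow_complement_mul p_pr q_pr neq_pq oG sylR sylQ.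
have QG := pHall_sub sylQ.
have <- : #|G : Q| = p by rewrite -divgS // oG oQ mulnK // expn_gt0 prime_gt0.
by rewrite (card_Syl sylQ) dvdn_leq // indexgS // subsetI QG normG.
Qed.

Lemma card_noncommuting_pairs G p q n :
    prime p -> prime q -> p != q -> 1 < n -> #|G| = (p * q ^ n)%N ->
    classC G ->
  #|subgroups G| ^ 2 <= #|commuting_pairs G| + p ^ 2.
Proof.
move=> p_pr q_pr neq_pq n_gt1 oG /andP[minG modG].
have [P sylP] := Sylow_exists p G.
have nPG := Sylow_p_normal p_pr q_pr neq_pq n_gt1 oG minG modG sylP.
have mulC := mulgC_not_Sylow p_pr q_pr neq_pq oG minG nPG sylP.
have le_Syl := card_Syl_leq p_pr q_pr neq_pq oG.
have sub : setX (subgroups G) (subgroups G) \subset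
    commuting_pairs G :|: setX 'Syl_q(G) 'Syl_q(G).
  apply/subsetP=> -[H K]; rewrite !inE /= => /andP[HG KG]; rewrite HG KG /=.
  have [sylH | nsylH] := boolP (q.-Sylow(G) H); last first.
    by rewrite (mulC H K) ?eqxx.
  have [sylK | nsylK] := boolP (q.-Sylow(G) K); first by rewrite orbT.
  by rewrite (mulC K H) ?eqxx.
have := subset_leq_card sub; rewrite cardsX mulnn => /leq_trans; apply.
rewrite (leq_trans (leq_card_setU _ _)) // leq_add2l cardsX -mulnn.
exact: leq_mul.
Qed.

Lemma card_subgroups_gt G q n :
  prime q -> q ^ n %| #|G| -> n < #|subgroups G|.
Proof.
move=> q_pr dvG.
have [Q sylQ] := Sylow_exists q G.
have le_n : n <= logn q #|Q|.
  by rewrite (card_Hall sylQ) p_part pfactorK // -pfactor_dvdn.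
(* [inord] sends exponents above [n] to 0; this is harmless, since only surjectivity matters. *)
pose f (H : {group gT}) : 'I_n.+1 := inord (logn q #|H|).
suff /subset_leq_card : [set: 'I_n.+1] \subset f @: subgroups G.
  by rewrite cardsT card_ord => /leq_trans; apply; exact: leq_imset_card.
apply/subsetP=> i _.
have [H [HQ _ oH]] :
    exists H : {group gT}, [/\ H \subset Q, H <| Q & #|H| = (q ^ i)%N].
  apply: normal_pgroup (pHall_pgroup sylQ) (normal_refl Q) _.
  by rewrite (leq_trans _ le_n) // -ltnS.
apply/imsetP; exists H.
  by rewrite inE (subset_trans HQ) ?(pHall_sub sylQ).
by rewrite /f oH pfactorK // inord_val.
Qed.

(** * Bounds for [sd] *)

Lemma sd_le1 G : (sd G <= 1)%R.
Proof.
rewrite /sd ler_pdivrMr ?mul1r; last first.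
  by rewrite exprn_gt0 // ltr0n; apply/card_gt0P; exists G; rewrite inE.
rewrite -natrX ler_nat -mulnn -cardsX subset_leq_card //.
by apply/subsetP=> HK; rewrite !inE => /andP[].
Qed.

Lemma sd_classC_ge G p q n :
    prime p -> prime q -> p != q -> 1 < n -> #|G| = (p * q ^ n)%N ->
    classC G ->
  (1 - (p ^ 2)%:R * n.+1%:R^-1 <= sd G)%R.
Proof.
move=> p_pr q_pr neq_pq n_gt1 oG GC.
have le_pairs := card_noncommuting_pairs p_pr q_pr neq_pq n_gt1 oG GC.
have lt_n : n < #|subgroups G|.
  by apply: (card_subgroups_gt q_pr); rewrite oG dvdn_mull.
set L := #|subgroups G| in le_pairs lt_n.
have L2_gt0 : (0 < L%:R ^+ 2 :> rat)%R.
  by rewrite exprn_gt0 // ltr0n (leq_ltn_trans _ lt_n).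
rewrite /sd -/L ler_pdivlMr // mulrBl mul1r lerBlDr.
apply: le_trans (_ : (#|commuting_pairs G|%:R + (p ^ 2)%:R <= _)%R).
  by rewrite -natrX -natrD ler_nat.
(* What remains is [n + 1 <= L ^ 2], which follows from [n < L]. *)
rewrite lerD2l -mulrA ler_peMr ?ler0n //.
rewrite mulrC ler_pdivlMr ?ltr0n // mul1r -natrX ler_nat.
by rewrite (leq_trans lt_n) // -mulnn leq_pmulr // (leq_ltn_trans _ lt_n).
Qed.

End GroupTheory.

(* The [<|] notation of MathComp-Analysis clashes with group normality. *)
From mathcomp Require Import all_classical all_reals all_analysis.

Import numFieldNormedType.Exports.

Local Open Scope classical_set_scope.
Local Open Scope ring_scope.

Theorem theorem4 (R : realType) (p q : nat)
    (p_prime : prime p) (q_prime : prime q) (pq : p = 1 %[mod q])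
    (gT : nat -> finGroupType) (G : forall n : nat, {group gT n})
    (cardG : forall n : nat, (1 <= n)%N -> #|G n| = (p * q ^ n)%N)
    (GC : forall n : nat, (1 <= n)%N -> classC (G n)) :
  (ratr (sd (G n)) : R) @[n --> \oo] --> (1 : R).
Proof.
have neq_pq : p != q.
  apply: contra_eq_neq pq => ->.
  by rewrite modnn modn_small ?prime_gt1.
(* [harmonic n] is [1 / (n + 1)], the rate in [sd_classC_ge]. *)
have cvg_low : 1 - (p ^ 2)%:R * harmonic n @[n --> \oo] --> (1 : R).
  rewrite -[X in _ --> X]subr0 -[X in _ --> _ - X](mulr0 (p ^ 2)%:R).
  by apply: cvgB; [exact: cvg_cst | apply: cvgMr; exact: cvg_harmonic].
apply: (squeeze_cvgr _ cvg_low); last exact: (cvg_cst (1 : R)).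
near=> n; have n_gt1 : (1 < n)%N by near: n; exact: nbhs_infty_gt.
have n_ge1 := ltnW n_gt1.
apply/andP; split; last by rewrite -(rmorph1 (@ratr R)) ler_rat sd_le1.
have -> : 1 - (p ^ 2)%:R * harmonic n = ratr (1 - (p ^ 2)%:R * n.+1%:R^-1) :> R.
  by rewrite rmorphB rmorph1 (rmorphM (@ratr R)) fmorphV !rmorph_nat.
by rewrite ler_rat (sd_classC_ge p_prime q_prime neq_pq n_gt1) ?cardG ?GC.
Unshelve. all: by end_near.
Qed.
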